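(* Let $H$ be a self-adjoint operator acting in $\ell^2(\mathbb{Z})$. Suppose that there exist an orthonormal basis $\{\phi_m\}_{m\in\mathbb{Z}}$ of $\ell^2(\mathbb{Z})$ consisting of eigenfunctions of $H$ and an $\alpha>0$ such that $$|\phi_m(n)|\le\frac{\gamma_\alpha}{|n-m|^\alpha},\qquad m,n\in\mathbb{Z},\ n\ne m,$$ for some $\gamma_\alpha>0$ depending only on $\alpha$ (in particular, not on $m$ and $n$). Let $q>0$. If $\alpha>\frac32+\frac q2$, then for every $k\in\mathbb{Z}$ there is a finite constant $C_{q,k}$ such that $$\sup_{t\in\mathbb{R}}\sum_{n\in\mathbb{Z}}|n|^q\,|\langle e^{-itH}\delta_k,\delta_n\rangle|^2<C_{q,k}.$$
   Context: $\{\delta_n\}_{n\in\mathbb{Z}}$ is the canonical orthonormal basis of $\ell^2(\mathbb{Z})$. *)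

(* Defs.v *)
From HB Require Import structures.
From mathcomp Require Import all_boot all_order all_algebra.
From mathcomp Require Import all_classical all_reals all_analysis.
From mathcomp Require Import complex ring.
Set Implicit Arguments.
Unset Strict Implicit.
Unset Printing Implicit Defensive.
Import Order.TTheory GRing.Theory Num.Theory.
Import numFieldNormedType.Exports.
Local Open Scope classical_set_scope.
Local Open Scope ring_scope.
Local Open Scope complex_scope.

(* The modulus with values in [R]; the generic norm [`|z|] has values in
   [R[i]]. *)
Notation normc := ComplexField.Normc.normc.

Section SquareSummable.
Variable R : realType.

Definition sqsum (f : int -> R[i]) : \bar R :=
  (\esum_(n in [set: int]) (normc (f n) ^+ 2)%:E)%E.

Definition ell2_pred : {pred int -> R[i]^o} := [pred f | `[< (sqsum f < +oo)%E >]].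

Lemma sqr_normcD (a b : R[i]) :
  normc (a + b) ^+ 2 <= 2 * (normc a ^+ 2 + normc b ^+ 2).
Proof.
case: a b => [a1 a2] [b1 b2] /=.
rewrite !sqr_sqrtr ?addr_ge0 ?sqr_ge0 // -subr_ge0.
rewrite [X in 0 <= X](_ : _ = (a1 - b1) ^+ 2 + (a2 - b2) ^+ 2); last by ring.
by rewrite addr_ge0 ?sqr_ge0.
Qed.

Lemma sqsum_linear_lty (a : R[i]) (f g : int -> R[i]^o) :
  (sqsum f < +oo)%E -> (sqsum g < +oo)%E -> (sqsum (a *: f + g)%R < +oo)%E.
Proof.
move=> f2 g2; pose h n : \bar R := (normc (f n) ^+ 2 + normc (g n) ^+ 2)%:E.
pose c : R := 2 * (normc a ^+ 2 + 1).
have h0 n : (0 <= h n)%E by rewrite lee_fin addr_ge0 ?sqr_ge0.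
have c0 : 0 <= c by rewrite mulr_ge0 ?addr_ge0 ?sqr_ge0.
apply: (@le_lt_trans _ _ (c%:E * \esum_(n in [set: int]) h n)%E); last first.
  rewrite lte_mul_pinfty ?lee_fin //.
  rewrite (eq_esum (b := fun n => (normc (f n) ^+ 2)%:E + (normc (g n) ^+ 2)%:E)%E).
    by rewrite esumD ?lte_add_pinfty // => n _; rewrite lee_fin sqr_ge0.
  by move=> n _; rewrite /h EFinD.
rewrite /sqsum /esum ge_ereal_sup //= => _ [X [finX _]] <-.
apply: (@le_trans _ _ (\sum_(n \in X) (c%:E * h n))%E).
  apply: lee_fsum => // n _; rewrite -EFinM lee_fin.
  rewrite (le_trans (sqr_normcD _ _)) // /c -mulrA ler_wpM2l //.
  rewrite ComplexField.Normc.normcM exprMn -subr_ge0.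
  rewrite [X in 0 <= X](_ : _ = normc a ^+ 2 * normc (g n) ^+ 2
    + normc (f n) ^+ 2); last by ring.
  by apply: addr_ge0; [apply: mulr_ge0|]; exact: sqr_ge0.
rewrite -ge0_mule_fsumr // lee_wpmul2l ?lee_fin //.
by rewrite ereal_sup_ubound //=; exists X.
Qed.

Lemma ell2_submod_closed : submod_closed ell2_pred.
Proof.
split=> [|a f g /asboolP f2 /asboolP g2]; apply/asboolP.
  by rewrite /sqsum esum1 // => n _; rewrite ComplexField.Normc.normc0 expr0n.
exact: sqsum_linear_lty.
Qed.

HB.instance Definition _ :=
  GRing.isSubmodClosed.Build R[i] (int -> R[i]^o) ell2_pred ell2_submod_closed.

Record ell2 := Ell2 { ell2_fun :> int -> R[i]^o; _ : ell2_fun \in ell2_pred }.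

HB.instance Definition _ := [isSub for ell2_fun].
HB.instance Definition _ := [Choice of ell2 by <:].
HB.instance Definition _ := [SubChoice_isSubLmodule of ell2 by <:].

Lemma delta_subproof (k : int) :
  (fun n => (n == k)%:R : R[i]^o) \in ell2_pred.
Proof.
apply/asboolP; rewrite /sqsum.
rewrite (eq_esum (b := fun n => if n \in [set k] then 1%E else 0%E)); last first.
  move=> n _; have [->|nk] := eqVneq n k.
    by rewrite mem_set // ComplexField.Normc.normc1 expr1n.
  rewrite memNset; last exact/eqP.
  by rewrite ComplexField.Normc.normc0 expr0n.
by rewrite -esum_mkcond esum_set1 ?ltry.
Qed.

Definition delta (k : int) : ell2 := Ell2 (delta_subproof k).

(* Sums over Z of absolutely summable real and complex families; [esum] is
   meaningful for nonnegative terms only. *)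
Definition rsum (u : int -> R) : R :=
  let v n := (u n)%:E in
  fine (\esum_(n in [set: int]) v^\+ n - \esum_(n in [set: int]) v^\- n)%E.

Definition csum (u : int -> R[i]) : R[i] :=
  rsum (fun n => complex.Re (u n)) +i* rsum (fun n => complex.Im (u n)).

Definition dot (f g : ell2) : R[i] := csum (fun n => f n * conjc (g n)).

Definition norm2 (f : ell2) : R := Num.sqrt (fine (sqsum f)).

(* A possibly unbounded linear operator; the values of [app] outside [dom]
   carry no meaning. *)
Record operator := Operator {
  dom : set ell2;
  app :> ell2 -> ell2;
  dom0 : dom 0;
  domP : forall (a : R[i]) f g, dom f -> dom g -> dom (a *: f + g);
  appP : forall (a : R[i]) f g, dom f -> dom g ->
    app (a *: f + g) = a *: app f + app g }.

Definition densely_defined (T : operator) : Prop :=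
  forall f (e : R), 0 < e -> exists2 g, dom T g & norm2 (f - g) < e.

(* [adjoint_graph T g h] : g is in the domain of the adjoint of T, which sends
   it to h. *)
Definition adjoint_graph (T : operator) (g h : ell2) : Prop :=
  forall f, dom T f -> dot (T f) g = dot f h.

Definition self_adjoint (T : operator) : Prop :=
  densely_defined T /\
  forall g h, adjoint_graph T g h <-> dom T g /\ T g = h.

Definition eigenfunction (T : operator) (f : ell2) : Prop :=
  f != 0 /\ exists l : R[i], dom T f /\ T f = l *: f.

Definition orthonormal_basis (phi : int -> ell2) : Prop :=
  (forall m m', dot (phi m) (phi m') = (m == m')%:R) /\
  (forall f (e : R), 0 < e -> exists (s : seq int) (c : int -> R[i]),
     norm2 (f - \sum_(m <- s) c m *: phi m) < e).

(* [is_exp_mit T U] : U t = exp(-itT), in the sense of Stone's theorem: U is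
   the strongly continuous one-parameter unitary group with infinitesimal
   generator -iT, that is, dom T is exactly the set of those f for which the
   strong derivative of t |-> U t f at 0 exists, and this derivative is
   -i T f. For self-adjoint T such a U exists and is unique. Surjectivity of
   U t follows from the group law. *)
Record is_exp_mit (T : operator) (U : R -> {linear ell2 -> ell2}) : Prop := {
  exp_mit_unitary : forall t f g, dot (U t f) (U t g) = dot f g;
  exp_mit0 : forall f, U 0 f = f;
  exp_mitD : forall s t f, U (s + t) f = U s (U t f);
  exp_mit_cont : forall t f, norm2 (U s f - U t f) @[s --> t] --> (0 : R);
  exp_mit_gen : forall f g, dom T f /\ T f = g <->
    norm2 (t^-1%:C *: (U t f - f) + (0 +i* 1) *: g) @[t --> 0^'] --> (0 : R) }.

End SquareSummable.

Arguments delta {R} k.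

(* Main.v *)
Require Import Defs.
From mathcomp Require Import all_boot all_order all_algebra.
From mathcomp Require Import all_classical all_reals all_analysis.
From mathcomp Require Import complex.
From mathcomp Require Import ring lra.
Import Order.TTheory GRing.Theory Num.Theory.
Local Open Scope classical_set_scope.
Local Open Scope ring_scope.
Import numFieldNormedType.Exports.
Import ComplexField.Normc.

(* Expanding in the eigenbasis, |<U t delta_k, delta_n>| is at most the sum
   over m of |phi_m(k)| |phi_m(n)|, because U t multiplies each phi_m by a
   number of modulus 1.  That last fact is obtained without exponentials: the
   distance from U t phi_m to the line spanned by phi_m is subadditive in t
   (each U t is a linear isometry) and is o(t) at 0, hence vanishes.

   Write <j> for 1 + |j|.  With beta = q/2 + 3/4, submultiplicativity of <.>
   and alpha - beta > 3/4 give
     <k-m>^-alpha <n-m>^-alpha <= <n-k>^-beta <k-m>^(-3/4) <n-m>^(-3/4),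
   whose sum over m is O(<n-k>^-beta) since <j>^(-3/2) is summable.  Finally
   |n|^q <n-k>^(-2 beta) <= <k>^q <n-k>^(-3/2) is again summable over n. *)

(** * Absolutely summable families over Z and linearity of [rsum] *)

Section AbsoluteSums.
Context {R : realType}.
Implicit Types (u v a b : int -> R).

Definition zsum u : \bar R := (\esum_(n in [set: int]) (u n)%:E)%E.

Definition zsummable u := summable [set: int] (EFin \o u).

Lemma zsumZ (k : R) u : 0 <= k -> (forall n, 0 <= u n) ->
  zsum (fun n => k * u n) = (k%:E * zsum u)%E.
Proof.
have le (l : R) (w : int -> R) : 0 <= l -> (forall n, 0 <= w n) ->
    (zsum (fun n => l * w n)%R <= l%:E * zsum w)%E.
  move=> l0 w0; rewrite /zsum /esum ge_ereal_sup //= => _ [X XT] <-.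
  under eq_fsbigr do rewrite EFinM.
  rewrite -ge0_mule_fsumr => [|n]; last by rewrite lee_fin.
  by rewrite lee_wpmul2l ?lee_fin //; apply: ereal_sup_ubound; exists X.
rewrite le_eqVlt => /predU1P[<- u0|k0 u0].
  by rewrite mul0e /zsum esum1 // => n _; rewrite mul0r.
(* The reverse inequality is [le] again, applied to the factor [k^-1] and the family [k * u]. *)
apply/eqP; rewrite eq_le le ?(ltW k0) //= muleC -lee_pdivlMr //.
rewrite muleC.
have := le k^-1 (fun n => k * u n); rewrite invr_ge0 (ltW k0) => /(_ isT).
under eq_fun do rewrite mulKf ?gt_eqF //.
by apply => n; rewrite mulr_ge0 // ltW.
Qed.

Lemma zsum_ge0 {u} : (forall n, 0 <= u n) -> (0 <= zsum u)%E.
Proof. by move=> u0; apply: esum_ge0 => n _; rewrite lee_fin. Qed.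

Lemma ge0_zsummable {u} : (forall n, 0 <= u n) ->
  zsummable u = (zsum u < +oo)%E.
Proof.
move=> u0; rewrite /zsummable /summable; congr (_ < _)%E.
by apply: eq_esum => n _ /=; rewrite ger0_norm.
Qed.

Lemma le_zsummable u v : (forall n, `|u n| <= `|v n|) ->
  zsummable v -> zsummable u.
Proof.
move=> uv; apply: le_lt_trans; apply: le_esum => n _ /=.
by rewrite lee_fin.
Qed.

Lemma zsummableD u v : zsummable u -> zsummable v -> zsummable (u \+ v).
Proof. exact: summableD. Qed.

Lemma zsummableZ (k : R) u : zsummable u -> zsummable (fun n => k * u n).
Proof.
move=> us; have nu0 n : 0 <= `|u n| by [].
apply: (@le_zsummable _ (fun n => `|k| * `|u n|)) => [n|].
  by rewrite !normrM !normr_id.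
rewrite ge0_zsummable => [|n]; last by rewrite mulr_ge0.
by rewrite zsumZ // lte_mul_pinfty ?lee_fin // -ge0_zsummable.
Qed.

Lemma zsum_fin u : (forall n, 0 <= u n) -> zsummable u -> zsum u \is a fin_num.
Proof. by move=> u0; rewrite ge0_zsummable // ge0_fin_numE ?zsum_ge0. Qed.

(** Any splitting into a difference of nonnegative summable families may replace the positive and
    negative parts that define [rsum]. This freedom is what makes the linearity lemmas below
    short. *)
Lemma rsumB_ge0 a b : (forall n, 0 <= a n) -> (forall n, 0 <= b n) ->
  zsummable a -> zsummable b -> rsum (a \- b) = fine (zsum a) - fine (zsum b).
Proof.
move=> a0 b0 sa sb; rewrite -fineB ?zsum_fin //; congr fine.
rewrite -(esumB sa sb) => [||n _]; rewrite ?lee_fin //.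
by move=> n _; rewrite lee_fin.
Qed.

Lemma rsum_ge0 u : (forall n, 0 <= u n) -> zsummable u ->
  rsum u = fine (zsum u).
Proof.
move=> u0 us; have c0 (n : int) : 0 <= cst 0 n :> R by [].
have s0 : zsum (cst 0) = 0%E by rewrite /zsum esum1.
have sc : zsummable (cst 0) by rewrite ge0_zsummable // s0.
transitivity (rsum (u \- cst 0)).
  by congr rsum; apply/funext => n /=; rewrite subr0.
by rewrite rsumB_ge0 // s0 subr0.
Qed.

Lemma zsummable_posneg u : zsummable u -> exists a b, [/\ forall n, 0 <= a n,
  forall n, 0 <= b n, zsummable a, zsummable b & u = a \- b].
Proof.
move=> us; exists (fun n => Num.max (u n) 0), (fun n => Num.max (- u n) 0).
split.
- by move=> n; rewrite le_max lexx orbT.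
- by move=> n; rewrite le_max lexx orbT.
- apply: le_zsummable us => n.
  rewrite [`|Num.max _ _|]ger0_norm; last by rewrite le_max lexx orbT.
  by rewrite ge_max ler_norm normr_ge0.
- apply: le_zsummable us => n.
  rewrite [`|Num.max _ _|]ger0_norm; last by rewrite le_max lexx orbT.
  by rewrite ge_max normr_ge0 andbT -normrN ler_norm.
- by apply/funext => n /=; rewrite !maxEle; do 2 case: ifP; lra.
Qed.

Lemma rsumN u : zsummable u -> rsum (fun n => - u n) = - rsum u.
Proof.
move=> /zsummable_posneg[a [b [a0 b0 sa sb ->]]].
rewrite rsumB_ge0 // opprB -rsumB_ge0 //.
by congr rsum; apply/funext => n /=; rewrite opprB.
Qed.

Lemma rsumD u v : zsummable u -> zsummable v ->
  rsum (fun n => u n + v n) = rsum u + rsum v.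
Proof.
move=> /zsummable_posneg[a [b [a0 b0 sa sb ->]]].
move=> /zsummable_posneg[c [d [c0 d0 sc sd ->]]].
have D f g : (forall n, 0 <= f n) -> (forall n, 0 <= g n) ->
    zsummable f -> zsummable g ->
    fine (zsum (f \+ g)) = fine (zsum f) + fine (zsum g).
  move=> f0 g0 sf sg; rewrite -fineD ?zsum_fin // /zsum -esumD // => n _.
    exact: f0.
  exact: g0.
rewrite !rsumB_ge0 // addrACA -opprD -!D // -rsumB_ge0 ?zsummableD //.
- by congr rsum; apply/funext => n /=; ring.
- by move=> n; rewrite addr_ge0.
- by move=> n; rewrite addr_ge0.
Qed.

Lemma rsumZ (k : R) u : zsummable u -> rsum (fun n => k * u n) = k * rsum u.
Proof.
(* Nonnegative sums scale only by nonnegative factors; a negative [k] is reached through [- k] and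
   [rsumN]. *)
wlog k0 : k / 0 <= k.
  move=> hw us; have [] := leP 0 k => [k0|k0]; first exact: hw.
  rewrite -[k in RHS]opprK mulNr -hw ?oppr_ge0 ?(ltW k0) // -rsumN.
    by congr rsum; apply/funext => n; ring.
  exact: zsummableZ.
move=> /zsummable_posneg[a [b [a0 b0 sa sb ->]]].
have Z f : (forall n, 0 <= f n) -> zsummable f ->
    fine (zsum (fun n => k * f n)) = k * fine (zsum f).
  by move=> f0 sf; rewrite zsumZ // fineM ?zsum_fin.
rewrite rsumB_ge0 // mulrBr -!Z // -rsumB_ge0.
- by congr rsum; apply/funext => n /=; ring.
- by move=> n; rewrite mulr_ge0.
- by move=> n; rewrite mulr_ge0.
- exact: zsummableZ.
- exact: zsummableZ.
Qed.

End AbsoluteSums.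

(** * Inner product and norm of the square-summable sequences *)

Section InnerProduct.
Context {R : realType}.
Implicit Types (f g h : ell2 R) (a : R[i]).
Local Open Scope complex_scope.

Lemma normc_ge0 (z : R[i]) : 0 <= normc z.
Proof. by case: z => x y /=; exact: sqrtr_ge0. Qed.

Lemma sqr_normcE (z : R[i]) :
  normc z ^+ 2 = complex.Re z ^+ 2 + complex.Im z ^+ 2.
Proof. by case: z => x y /=; rewrite sqr_sqrtr ?addr_ge0 ?sqr_ge0. Qed.

Lemma normcJ (z : R[i]) : normc (conjc z) = normc z.
Proof. by case: z => x y /=; rewrite sqrrN. Qed.

Lemma normcZ (x : R) : 0 <= x -> normc x%:C = x.
Proof. by move=> x0 /=; rewrite expr0n /= addr0 sqrtr_sqr ger0_norm. Qed.

Lemma Re_le_normc (z : R[i]) : `|complex.Re z| <= normc z.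
Proof.
by case: z => x y /=; rewrite -sqrtr_sqr ler_wsqrtr // lerDl sqr_ge0.
Qed.

Lemma Im_le_normc (z : R[i]) : `|complex.Im z| <= normc z.
Proof.
by case: z => x y /=; rewrite -sqrtr_sqr ler_wsqrtr // lerDr sqr_ge0.
Qed.

Lemma mulcJ (z : R[i]) : z * conjc z = (normc z ^+ 2)%:C.
Proof.
rewrite sqr_normcE; case: z => x y; apply/eqP.
by rewrite eq_complex /=; apply/andP; split; apply/eqP; ring.
Qed.

Lemma ell2ZE a f n : (a *: f) n = a * f n.
Proof. by []. Qed.

Lemma ell2_lty f : (sqsum f < +oo)%E.
Proof. by case: f => f /= /asboolP. Qed.

Lemma zsummable_sqr f : zsummable (fun n => normc (f n) ^+ 2).
Proof. by rewrite ge0_zsummable ?ell2_lty // => n; rewrite sqr_ge0. Qed.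

(** Since ab <= a^2 + b^2, the family is dominated by the sum of two summable ones. The real and
    imaginary series in [dot] thus converge absolutely, so that [rsum] is linear on them. *)
Lemma zsummable_dot f g : zsummable (fun n => normc (f n * conjc (g n))).
Proof.
have := zsummableD _ _ (zsummable_sqr f) (zsummable_sqr g).
apply: le_zsummable => n /=.
rewrite normcM normcJ !ger0_norm ?addr_ge0 ?sqr_ge0 ?mulr_ge0 ?normc_ge0 //.
have := sqr_ge0 (normc (f n) - normc (g n)); have := normc_ge0 (f n).
by have := normc_ge0 (g n); nra.
Qed.

Lemma zsummable_Re_dot f g :
  zsummable (fun n => complex.Re (f n * conjc (g n))).
Proof.
apply: le_zsummable (zsummable_dot f g) => n.
by rewrite (le_trans (Re_le_normc _)) // ler_norm.
Qed.

Lemma zsummable_Im_dot f g :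
  zsummable (fun n => complex.Im (f n * conjc (g n))).
Proof.
apply: le_zsummable (zsummable_dot f g) => n.
by rewrite (le_trans (Im_le_normc _)) // ler_norm.
Qed.

Lemma dotDl f g h : dot (f + g) h = dot f h + dot g h.
Proof.
rewrite /dot /csum; apply/eqP; rewrite eq_complex; apply/andP.
split; apply/eqP => /=.
  rewrite -(rsumD _ _ (zsummable_Re_dot f h) (zsummable_Re_dot g h)).
  by congr rsum; apply/funext => n /=; rewrite mulrDl raddfD.
rewrite -(rsumD _ _ (zsummable_Im_dot f h) (zsummable_Im_dot g h)).
by congr rsum; apply/funext => n /=; rewrite mulrDl raddfD.
Qed.

Lemma dotZl a f h : dot (a *: f) h = a * dot f h.
Proof.
rewrite /dot /csum; case: a => x y; apply/eqP; rewrite eq_complex; apply/andP.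
have re := zsummable_Re_dot f h; have im := zsummable_Im_dot f h.
split; apply/eqP; rewrite [RHS]/= -!rsumZ //.
  rewrite -rsumN; last exact: zsummableZ.
  rewrite -rsumD; [|exact: zsummableZ|].
    rewrite [LHS]/complex.Re; congr rsum; apply/funext => n; rewrite ell2ZE.
    by case: (f n) (h n) => [f1 f2] [h1 h2] /=; ring.
  under eq_fun do rewrite -mulNr; exact: zsummableZ.
rewrite -rsumD; [|exact: zsummableZ|exact: zsummableZ].
rewrite [LHS]/complex.Im; congr rsum; apply/funext => n; rewrite ell2ZE.
by case: (f n) (h n) => [f1 f2] [h1 h2] /=; ring.
Qed.

Lemma dotC f g : dot g f = conjc (dot f g).
Proof.
rewrite /dot /csum /= -rsumN; last exact: zsummable_Im_dot.
congr (_ +i* _); congr rsum; apply/funext => n;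
by case: (f n) (g n) => [f1 f2] [h1 h2] /=; ring.
Qed.

Lemma dotDr f g h : dot h (f + g) = dot h f + dot h g.
Proof. by rewrite !(dotC _ h) dotDl rmorphD. Qed.

Lemma dotZr a f h : dot h (a *: f) = conjc a * dot h f.
Proof. by rewrite !(dotC _ h) dotZl rmorphM. Qed.

Lemma dot0l f : dot 0 f = 0.
Proof. by rewrite -(scale0r 0) dotZl mul0r. Qed.

Lemma dot0r f : dot f 0 = 0.
Proof. by rewrite -(scale0r 0) dotZr conjc0 mul0r. Qed.

Lemma dotNl f g : dot (- f) g = - dot f g.
Proof. by rewrite -scaleN1r dotZl mulN1r. Qed.

Lemma dotNr f g : dot f (- g) = - dot f g.
Proof. by rewrite !(dotC _ f) dotNl rmorphN. Qed.

Lemma dot_suml (I : Type) (s : seq I) (F : I -> ell2 R) h :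
  dot (\sum_(i <- s) F i) h = \sum_(i <- s) dot (F i) h.
Proof. by elim/big_rec2: _ => [|i x y _ <-]; rewrite ?dot0l ?dotDl. Qed.

Lemma dot_sumr (I : Type) (s : seq I) (F : I -> ell2 R) h :
  dot h (\sum_(i <- s) F i) = \sum_(i <- s) dot h (F i).
Proof. by elim/big_rec2: _ => [|i x y _ <-]; rewrite ?dot0r ?dotDr. Qed.

Lemma norm2_ge0 f : 0 <= norm2 f. Proof. exact: sqrtr_ge0. Qed.

Lemma sqr_norm2 f : norm2 f ^+ 2 = fine (sqsum f).
Proof.
rewrite sqr_sqrtr // fine_ge0 //; apply: esum_ge0 => n _.
by rewrite lee_fin sqr_ge0.
Qed.

Lemma dot_norm2 f : dot f f = (norm2 f ^+ 2)%:C.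
Proof.
rewrite sqr_norm2 /dot /csum; congr (_ +i* _).
  rewrite -[sqsum f]/(zsum (fun n => normc (f n) ^+ 2)).
  rewrite -rsum_ge0; [|by move=> n; rewrite sqr_ge0|exact: zsummable_sqr].
  by congr rsum; apply/funext => n; rewrite mulcJ.
have s0 : zsum (fun=> 0) = 0%E :> \bar R by rewrite /zsum esum1.
have as0 : zsummable (fun=> 0 : R) by rewrite ge0_zsummable // s0.
transitivity (rsum (fun=> 0) : R); last by rewrite rsum_ge0 // s0.
by congr rsum; apply/funext => n; rewrite mulcJ.
Qed.

Lemma normc_le_norm2 f n : normc (f n) <= norm2 f.
Proof.
rewrite -ler_sqr ?nnegrE ?norm2_ge0 ?normc_ge0 // sqr_norm2 -lee_fin.
rewrite fineK ?ge0_fin_numE ?ell2_lty //; last first.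
  by apply: esum_ge0 => m _; rewrite lee_fin sqr_ge0.
apply: esum_ge; exists [set n]; first by split.
by rewrite fsbig_set1.
Qed.

Lemma dot_delta f n : dot f (delta n) = f n.
Proof.
have R0 (u : int -> R) x : (forall m, u m = (m == n)%:R * x) -> rsum u = x.
  move=> uE; have s1 : zsum (fun m => (m == n)%:R : R) = 1%E.
    rewrite /zsum (eq_esum (b := fun m => if m \in [set n] then 1%E else 0%E)).
      by rewrite -esum_mkcond esum_set1.
    move=> m _; have [->|nk] := eqVneq m n; first by rewrite mem_set.
    by rewrite memNset //; exact/eqP.
  have s : zsummable (fun m => (m == n)%:R : R).
    by rewrite ge0_zsummable // s1 ltry.
  transitivity (rsum (fun m => x * (m == n)%:R)).
    by congr rsum; apply/funext => m; rewrite uE mulrC.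
  by rewrite rsumZ // rsum_ge0 // s1 /= mulr1.
rewrite /dot /csum (R0 _ (complex.Re (f n))) ?(R0 _ (complex.Im (f n))).
- by case: (f n).
- move=> m /=; have [->|_] := eqVneq m n; first by case: (f n) => x y /=; ring.
  by rewrite conjc0 mulr0 mul0r.
- move=> m /=; have [->|_] := eqVneq m n; first by case: (f n) => x y /=; ring.
  by rewrite conjc0 mulr0 mul0r.
Qed.

Lemma norm2D_sqr f g : norm2 (f + g) ^+ 2 =
  norm2 f ^+ 2 + 2 * complex.Re (dot f g) + norm2 g ^+ 2.
Proof.
have := dot_norm2 (f + g).
rewrite !(dotDl, dotDr) (dotC f g) !dot_norm2 => /(congr1 (@complex.Re R)) /=.
by case: (dot f g) => x y /= <-; ring.
Qed.

Lemma norm2Z a f : norm2 (a *: f) = normc a * norm2 f.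
Proof.
apply/eqP; rewrite -(@eqrXn2 _ 2) ?mulr_ge0 ?norm2_ge0 ?normc_ge0 //.
have := dot_norm2 (a *: f); rewrite dotZl dotZr mulrA mulcJ dot_norm2.
by move=> /(congr1 (@complex.Re R)) /= <-; apply/eqP; ring.
Qed.

Lemma norm2_eq0 f : norm2 f = 0 -> f = 0.
Proof.
move=> f0; apply: val_inj; apply/funext => n; apply: eq0_normc.
by apply/eqP; rewrite eq_le normc_ge0 andbT -f0 normc_le_norm2.
Qed.

Lemma norm2_triangle f g : norm2 (f + g) <= norm2 f + norm2 g.
Proof.
have f0 := norm2_ge0 f; have g0 := norm2_ge0 g.
suff CS : complex.Re (dot f g) <= norm2 f * norm2 g.
  by rewrite -ler_sqr ?nnegrE ?addr_ge0 ?norm2_ge0 // norm2D_sqr; nra.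
have [/norm2_eq0 ->|fn0] := eqVneq (norm2 f) 0.
  by rewrite dot0l mulr_ge0 ?norm2_ge0.
have [/norm2_eq0 ->|gn0] := eqVneq (norm2 g) 0.
  by rewrite dot0r mulr_ge0 ?norm2_ge0.
have fg0 : 0 < norm2 f * norm2 g by rewrite mulr_gt0 ?lt0r ?fn0 ?gn0.
(* Cauchy-Schwarz: with F and G the norms of f and g, the squared norm of G f - F g equals 2 F G (F
   G - Re<f,g>), and F G > 0 can be cancelled. *)
have := sqr_ge0 (norm2 ((norm2 g)%:C *: f + (- norm2 f)%:C *: g)).
rewrite norm2D_sqr !norm2Z dotZl dotZr.
rewrite (_ : normc (- norm2 f)%:C = norm2 f); last first.
  by rewrite (rmorphN (real_complex R)) normcN normcZ.
rewrite normcZ //; case: (dot f g) => x y /= H.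
rewrite -(ler_pM2l fg0) -subr_ge0.
by move: H; rewrite -(pmulr_rge0 _ (ltr0Sn _ 1)); congr (0 <= _); ring.
Qed.

End InnerProduct.

(** * Orthonormal families and pointwise expansion *)

Section OrthonormalFamilies.
Context {R : realType}.
Implicit Types (f g : ell2 R).
Local Open Scope complex_scope.

Lemma ell2_sumE (I : Type) (s : seq I) (F : I -> ell2 R) n :
  (\sum_(i <- s) F i) n = \sum_(i <- s) F i n.
Proof. by elim/big_rec2: _ => // i x y _ <-. Qed.

Lemma normc_sum (I : Type) (s : seq I) (F : I -> R[i]) :
  normc (\sum_(i <- s) F i) <= \sum_(i <- s) normc (F i).
Proof.
elim/big_rec2: _ => [|i x y _ le]; first by rewrite normc0.
by rewrite (le_trans (le_normcD _ _)) // lerD2l.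
Qed.

Lemma ler_norm2_sqr f g : (norm2 f ^+ 2 <= norm2 g ^+ 2) = (norm2 f <= norm2 g).
Proof. by rewrite ler_sqr ?nnegrE ?norm2_ge0. Qed.

Lemma norm2_le_of_orthogonal f g : dot f g = 0 -> norm2 f <= norm2 (f + g).
Proof.
move=> fg; rewrite -ler_norm2_sqr (norm2D_sqr f g) fg mulr0 addr0.
by rewrite lerDl sqr_ge0.
Qed.

(** The residual of the projection is orthogonal to every [phi m] with [m] in [s], hence to the
    difference of the two approximants. Duplicates are removed from [s] because the projection must
    count each basis vector once. *)
Lemma best_approximation (phi : int -> ell2 R) f (s : seq int)
    (c : int -> R[i]) :
  (forall m m', dot (phi m) (phi m') = (m == m')%:R) ->
  norm2 (f - \sum_(m <- undup s) dot f (phi m) *: phi m) <=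
  norm2 (f - \sum_(m <- s) c m *: phi m).
Proof.
move=> on; set p := \sum_(m <- undup s) _; set g := \sum_(m <- s) _.
have r0 m : m \in s -> dot (f - p) (phi m) = 0.
  move=> ms; rewrite dotDl dotNl /p dot_suml.
  rewrite (bigD1_seq m) ?mem_undup ?undup_uniq //=.
  rewrite dotZl on eqxx mulr1 big1 ?addr0 ?subrr // => j jm.
  by rewrite dotZl on (negbTE jm) mulr0.
have rs (w : seq int) (d : int -> R[i]) : {subset w <= s} ->
    dot (f - p) (\sum_(m <- w) d m *: phi m) = 0.
  move=> ws; rewrite dot_sumr big_seq big1 // => m /ws ms.
  by rewrite dotZr r0 // mulr0.
rewrite (_ : f - g = (f - p) + (p - g)); last by rewrite addrA subrK.
apply: norm2_le_of_orthogonal; rewrite dotDr dotNr !rs ?oppr0 ?addr0 // => m.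
by rewrite mem_undup.
Qed.

(** This stands in for the infinite expansion of f at n: a finite projection comes within any [e] of
    f in norm, hence also at the point n, and its value at n is at most a partial sum bounded by
    [B]. *)
Lemma normc_le_expansion (phi : int -> ell2 R) f n (B : R) :
  orthonormal_basis phi ->
  (forall s, uniq s ->
    \sum_(m <- s) normc (dot f (phi m)) * normc (phi m n) <= B) ->
  normc (f n) <= B.
Proof.
move=> [on dense] fB; apply/ler_addgt0Pr => e e0.
have [s [c]] := dense f e e0.
move=> /(le_lt_trans (best_approximation phi f s c on)) se.
set p := \sum_(m <- undup s) _ in se.
have -> : f n = p n + (f - p) n by rewrite -{1}(subrK p f) addrC.
apply: (le_trans (le_normcD _ _)); apply: lerD.
  rewrite (le_trans _ (fB _ (undup_uniq s))) // /p ell2_sumE.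
  apply: (le_trans (normc_sum _ _ _)); apply: ler_sum => m _.
  by rewrite -normcM.
exact: le_trans (normc_le_norm2 _ _) (ltW se).
Qed.

End OrthonormalFamilies.

(** * Evolution of a normalized eigenfunction under the unitary group *)

Section EigenfunctionEvolution.
Context {R : realType}.
Variables (T : operator R) (U : R -> {linear ell2 R -> ell2 R}).
Hypothesis U_exp : is_exp_mit T U.
Variables (e : ell2 R) (l : R[i]).
Hypotheses (domTe : dom T e) (Te : T e = l *: e) (e1 : dot e e = 1).
Local Open Scope complex_scope.

Let norm2e : norm2 e = 1.
Proof.
apply/eqP; rewrite -(@eqrXn2 _ 2) ?norm2_ge0 ?ler01 // expr1n.
by have := e1; rewrite dot_norm2 => -[->].
Qed.

Let perp (g : ell2 R) : ell2 R := g - dot g e *: e.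

Let pythagoras (g : ell2 R) (c : R[i]) :
  norm2 (g - c *: e) ^+ 2 = norm2 (perp g) ^+ 2 + normc (dot g e - c) ^+ 2.
Proof.
rewrite (_ : g - c *: e = perp g + (dot g e - c) *: e); last first.
  by rewrite /perp scalerBl addrA subrK.
rewrite (norm2D_sqr (perp g)) dotZr dotDl dotNl dotZl e1 mulr1 subrr.
rewrite mulr0 /= mulr0 addr0.
by rewrite norm2Z norm2e mulr1.
Qed.

Let norm2_perp_le (g : ell2 R) (c : R[i]) :
  norm2 (perp g) <= norm2 (g - c *: e).
Proof. by rewrite -ler_norm2_sqr [leRHS](pythagoras g c) lerDl sqr_ge0. Qed.

Let norm2U t g : norm2 (U t g) = norm2 g.
Proof.
apply/eqP; rewrite -(@eqrXn2 _ 2) ?norm2_ge0 //; apply/eqP.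
have := exp_mit_unitary U_exp t g g.
by rewrite !dot_norm2 => -[].
Qed.

Let normc_dotU t : normc (dot (U t e) e) <= 1.
Proof.
rewrite -ler_sqr ?nnegrE ?normc_ge0 ?ler01 // expr1n.
have := pythagoras (U t e) 0; rewrite scale0r !subr0 norm2U norm2e expr1n => ->.
by rewrite lerDr sqr_ge0.
Qed.

Let dist t := norm2 (perp (U t e)).

Let distD s t : dist (s + t) <= dist s + dist t.
Proof.
(* The point [c * d *: e] of the line is compared with U (s + t) e: the error is c perp(U s e) + U s
   (perp (U t e)), where |c| <= 1 and U s is an isometry. *)
set c := dot (U t e) e; set d := dot (U s e) e.
apply: le_trans (norm2_perp_le _ (c * d)) _.
rewrite (exp_mitD U_exp) (_ : _ - _ = c *: perp (U s e) + U s (perp (U t e))).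
  rewrite (le_trans (norm2_triangle _ _)) // norm2Z norm2U lerD2r.
  by rewrite ler_piMl ?norm2_ge0 ?normc_dotU.
rewrite /perp -/c -/d scalerBr scalerA.
rewrite [U s (_ - _)]linearB [U s (_ *: _)]linearZ.
by rewrite [RHS]addrC addrA subrK.
Qed.

Let dist0 : dist 0 = 0.
Proof.
rewrite /dist /perp (exp_mit0 U_exp) e1 scale1r subrr.
by rewrite -(scale0r 0) norm2Z normc0 mul0r.
Qed.

Let distMn t n : dist (t *+ n) <= dist t *+ n.
Proof.
elim: n => [|n IH]; first by rewrite !mulr0n dist0.
by rewrite !mulrS (le_trans (distD _ _)) // lerD2l.
Qed.

Let dist_little_o (eps : R) : 0 < eps ->
  exists2 d, 0 < d & forall t, `|t| < d -> dist t <= eps * `|t|.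
Proof.
move=> eps0.
have := (exp_mit_gen U_exp e (l *: e)).1 (conj domTe Te).
move=> /cvgrPdist_lt/(_ eps eps0).
rewrite near_withinE => /nbhs_ballP[d /= d0 H]; exists d => // t td.
(* The derivative at 0 is a limit over nonzero times, so t = 0 is settled apart. *)
have [->|t0] := eqVneq t 0; first by rewrite dist0 normr0 mulr0.
have := H t; rewrite /ball /= sub0r normrN => /(_ td t0).
rewrite sub0r normrN ger0_norm ?norm2_ge0 // => /ltW Ht.
(* The first-order approximation (1 - i t l) e of U t e already lies on the line. *)
apply: le_trans (norm2_perp_le _ (1 - t%:C * ((0 +i* 1) * l))) _.
have t0C : t%:C != 0 by apply: contra t0 => /eqP[->].
have tV : t%:C * t^-1%:C = 1 by rewrite -(rmorphM (real_complex R)) divff.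
rewrite (_ : _ - _ = t%:C *: (t^-1%:C *: (U t e - e) + (0 +i* 1) *: (l *: e))).
  rewrite norm2Z (_ : normc t%:C = `|t|); last first.
    by rewrite /= expr0n addr0 sqrtr_sqr.
  by rewrite mulrC ler_wpM2r.
rewrite scalerDr !scalerA tV scale1r scalerBl scale1r.
by rewrite opprB addrA addrAC mulrA.
Qed.

Lemma eigenfunction_evolution t :
  exists2 c : R[i], normc c = 1 & U t e = c *: e.
Proof.
have dist_le eps : 0 < eps -> dist t <= eps * `|t|.
  move=> /dist_little_o[d d0 Hd].
  (* Cutting t into N steps shorter than [d] gives dist t <= N dist (t / N) <= N eps |t| / N = eps
     |t|. *)
  have [N N0 tN] : exists2 N : nat, (0 < N)%N & `|t| / N%:R < d.
    exists (Num.truncn (`|t| / d)).+1 => //.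
    by rewrite ltr_pdivrMr ?ltr0n // mulrC -ltr_pdivrMr // truncnS_gt.
  have N0' : N%:R != 0 :> R by rewrite pnatr_eq0 -lt0n.
  rewrite (_ : t = (t / N%:R) *+ N); last by rewrite -mulr_natr divfK.
  apply: le_trans (distMn _ _) _; rewrite normrMn mulrnAr lerMn2r -implyNb.
  by apply/implyP => _; apply: Hd; rewrite normrM normfV normr_nat.
have distt : dist t = 0.
  apply/eqP; rewrite eq_le norm2_ge0 andbT; apply/ler_addgt0Pr => eps eps0.
  (* Dividing by |t| + 1 instead of |t| covers t = 0 as well. *)
  rewrite add0r; have t1 : 0 < `|t| + 1 by rewrite ltr_wpDl.
  apply: le_trans (dist_le (eps / (`|t| + 1)) _) _; first by rewrite divr_gt0.
  by rewrite mulrAC ler_pdivrMr // ler_wpM2l ?(ltW eps0) // lerDl.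
exists (dot (U t e) e); last first.
  by apply/eqP; rewrite -subr_eq0; apply/eqP/norm2_eq0.
(* With zero distance, Pythagoras leaves the whole norm, which is 1, to the coefficient. *)
have := pythagoras (U t e) 0; rewrite -/(dist t) distt scale0r !subr0.
rewrite expr0n add0r norm2U norm2e => /eqP; rewrite eqrXn2 ?normc_ge0 ?ler01 //.
by move=> /eqP.
Qed.

(** Unitarity gives <f, e> = <U t f, U t e>, and U t e is e times a number of modulus 1. *)
Lemma normc_dot_evolution t f : normc (dot (U t f) e) = normc (dot f e).
Proof.
have [c c1 Ue] := eigenfunction_evolution t.
by rewrite -(exp_mit_unitary U_exp t f e) Ue dotZr normcM normcJ c1 mul1r.
Qed.

End EigenfunctionEvolution.

(** * The weights 1 + |j|: summability and convolution *)

Section BracketWeights.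
Context {R : realType}.

Lemma ler_sum_uniq_sub (I : eqType) (F : I -> R) (r s : seq I) :
  (forall i, 0 <= F i) -> uniq r -> uniq s -> {subset r <= s} ->
  \sum_(i <- r) F i <= \sum_(i <- s) F i.
Proof.
move=> F0 ur us rs; rewrite [leRHS](bigID (mem r)) /=.
rewrite -[X in _ <= X + _]big_filter [X in _ <= X + _](perm_big r).
  by rewrite lerDl sumr_ge0.
apply: uniq_perm => [||i]; rewrite ?filter_uniq // mem_filter.
by apply: andb_idr => /rs.
Qed.

(** Unlike |j|, this weight is at least 1 everywhere, so its powers are monotone in the exponent and
    negative ones are harmless at j = 0. *)
Definition bracket (j : int) : R := 1 + `|j%:~R|.

Lemma bracket_ge1 j : 1 <= bracket j. Proof. by rewrite lerDl. Qed.

Lemma bracket_gt0 j : 0 < bracket j.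
Proof. exact: lt_le_trans ltr01 (bracket_ge1 j). Qed.

Lemma bracketN j : bracket (- j) = bracket j.
Proof. by rewrite /bracket rmorphN normrN. Qed.

Lemma bracketD i j : bracket (i + j) <= bracket i * bracket j.
Proof.
have := ler_normD (i%:~R : R) j%:~R; rewrite /bracket rmorphD /=.
have := normr_ge0 (i%:~R : R); have := normr_ge0 (j%:~R : R); nra.
Qed.

Lemma powR_3half (x : R) : 0 < x ->
  x `^ (- (3 / 2)) = (x * Num.sqrt x)^-1.
Proof.
move=> x0; rewrite powRN (_ : 3 / 2 = 1 + 2^-1) //; last by field.
rewrite powRD; last by rewrite gt_eqF ?implybT.
by rewrite powRr1 ?ltW // powR12_sqrt // ltW.
Qed.

(* Telescoping: [x ^ (-3/2) <= 4 (x ^ (-1/2) - (x + 1) ^ (-1/2))] for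
   [x >= 1]. *)
Lemma sum_powR_3half N :
  \sum_(i <- iota 0 N) (1 + i%:R : R) `^ (- (3 / 2)) <=
  4 - 4 / Num.sqrt (1 + N%:R).
Proof.
elim: N => [|N IH]; first by rewrite big_nil addr0 sqrtr1 divr1 subrr.
rewrite -addn1 iotaD big_cat big_seq1 /= add0n addn1.
apply: le_trans (lerD IH (lexx _)) _.
have N0 : 0 <= N%:R :> R by [].
rewrite powR_3half ?ltr_wpDr // -[N.+1%:R]natr1.
set b := Num.sqrt (1 + N%:R); set c := Num.sqrt (1 + (N%:R + 1)).
have b2 : b * b = 1 + N%:R by rewrite -expr2 sqr_sqrtr // addr_ge0.
have c2 : c * c = b * b + 1 by rewrite -expr2 sqr_sqrtr ?b2 ?addr_ge0 //; ring.
have b1 : 1 <= b by rewrite -sqrtr1 ler_wsqrtr // lerDl.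
have bc : b <= c by rewrite ler_wsqrtr // lerD2l lerDl.
have b0 : 0 < b := lt_le_trans ltr01 b1.
have c0 : 0 < c := lt_le_trans b0 bc.
rewrite -b2 -subr_ge0.
rewrite (_ : _ - _ = (4 * b * b * (c - b) - c) / (b * b * b * c)); last first.
  by field; rewrite !gt_eqF.
apply: divr_ge0; last by rewrite !mulr_ge0 // ltW.
(* Multiplied by c + b, the numerator becomes 4 b^2 - c (c + b), because (c - b) (c + b) = 1; it is
   nonnegative by c <= 2 b, c^2 = b^2 + 1 and b >= 1. *)
have key : c <= 2 * b by nra.
have h : (c - b) * (c + b) = 1 by ring: c2.
have : 0 <= (4 * b * b * (c - b) - c) * (c + b).
  rewrite (_ : _ * _ = 4 * b * b * ((c - b) * (c + b)) - c * (c + b)).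
    by rewrite h mulr1; nra.
  by ring.
by rewrite pmulr_lge0 // addr_gt0.
Qed.

Lemma sum_bracket_bound : exists2 W : R, 0 <= W &
  forall s : seq int, uniq s -> \sum_(j <- s) bracket j `^ (- (3 / 2)) <= W.
Proof.
(* Each of the two half-lines contributes at most 4. [N] exceeds every |j|, so [s] embeds in two
   initial segments. *)
exists 8 => // s us; pose N := (\max_(j <- s) absz j).+1.
have iu : uniq ([seq Posz i | i <- iota 0 N] ++ [seq Negz i | i <- iota 0 N]).
  rewrite cat_uniq !map_inj_uniq ?iota_uniq ?andbT //; try by move=> ? ? [].
  by apply/hasPn => _ /mapP[i _ ->]; apply/mapP => -[].
apply: le_trans (ler_sum_uniq_sub _ _ _ _ _ us iu _) _.
- by move=> j; exact: powR_ge0.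
- move=> j js; have jN : (absz j < N)%N by rewrite ltnS leq_bigmax_seq.
  rewrite mem_cat; case: j js jN => j js jN.
    by rewrite map_f // mem_iota.
  by rewrite [X in _ || X]map_f ?orbT // mem_iota /= add0n ltnW.
have le4 : \sum_(i <- iota 0 N) (1 + i%:R : R) `^ (- (3 / 2)) <= 4.
  by rewrite (le_trans (sum_powR_3half N)) // gerBl divr_ge0 ?sqrtr_ge0.
rewrite big_cat !big_map (_ : 8 = 4 + 4 :> R); last by ring.
apply: lerD; apply: le_trans le4; apply: ler_sum => i _.
  by rewrite /bracket /= ger0_norm.
have i1 : 0 < 1 + i%:R :> R by rewrite ltr_wpDr.
(* [Negz i] is -(i + 1), with bracket 2 + i; the negative exponent reverses the comparison. *)
have le : 1 + i%:R <= bracket (Negz i).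
  by rewrite /bracket NegzE rmorphN normrN /= ger0_norm // lerD2l ler_nat.
rewrite !powRN lef_pV2 ?posrE ?powR_gt0 ?bracket_gt0 //.
by apply: ge0_ler_powR; rewrite ?nnegrE ?(ltW i1) // ltW ?bracket_gt0.
Qed.

(** By ab <= a^2 + b^2 the product of two powers -3/4 is at most a sum of two powers -3/2. Summed
    over m, each is a reindexed part of the series bounded by [W], whence the factor 2. *)
Lemma bracket_convolution (alpha q W : R) (n k : int) (s : seq int) :
  0 < q -> 3 / 2 + q / 2 < alpha ->
  (forall s : seq int, uniq s ->
    \sum_(j <- s) bracket j `^ (- (3 / 2)) <= W) ->
  uniq s ->
  \sum_(m <- s) bracket (k - m) `^ (- alpha) * bracket (n - m) `^ (- alpha) <=
  2 * W * bracket (n - k) `^ (- (q / 2 + 3 / 4)).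
Proof.
move=> q0 aq HW us; set beta := q / 2 + 3 / 4.
have ab : alpha - beta >= 3 / 4 by rewrite /beta; lra.
have beta0 : 0 <= beta by rewrite /beta; lra.
have br0 j : 0 <= bracket j := ltW (bracket_gt0 j).
have sumW (l : int) : \sum_(m <- s) bracket (l - m) `^ (- (3 / 2)) <= W.
  rewrite -(big_map (fun m => l - m) xpredT (fun j => bracket j `^ _)).
  by apply: HW; rewrite map_inj_uniq // => x y /addrI/oppr_inj.
apply: (@le_trans _ _ (\sum_(m <- s) (bracket (k - m) `^ (- (3 / 2)) +
    bracket (n - m) `^ (- (3 / 2))) * bracket (n - k) `^ (- beta))); last first.
  by rewrite -mulr_suml ler_wpM2r ?powR_ge0 // big_split (mulr_natl W 2) lerD.
apply: ler_sum => m _.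
rewrite [bracket (n - k) `^ _]powRN ler_pdivlMr ?powR_gt0 ?bracket_gt0 //.
set x := bracket (k - m); set y := bracket (n - m).
have xy : bracket (n - k) <= x * y.
  rewrite (_ : n - k = (n - m) - (k - m)); last by ring.
  by rewrite (le_trans (bracketD _ _)) // bracketN mulrC.
have half j : bracket j `^ (- (3 / 2)) =
    bracket j `^ (- (3 / 4)) * bracket j `^ (- (3 / 4)).
  rewrite -powRD; last by rewrite (gt_eqF (bracket_gt0 j)) implybT.
  by congr (_ `^ _); field.
(* Each factor pays for its share of <n-k>^beta and keeps the power -3/4, as beta - alpha <=
   -3/4. *)
have decay j : bracket j `^ (- alpha) * bracket j `^ beta <=
    bracket j `^ (- (3 / 4)).
  rewrite -powRD; last by rewrite (gt_eqF (bracket_gt0 j)) implybT.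
  by apply: ler_powR; [exact: bracket_ge1|lra].
have [x0 y0] : 0 <= x /\ 0 <= y by split; exact: br0.
have : bracket (n - k) `^ beta <= (x * y) `^ beta.
  by apply: ge0_ler_powR; rewrite ?nnegrE ?mulr_ge0 ?br0.
rewrite powRM // !half => xyb.
apply: (@le_trans _ _ ((x `^ (- alpha) * x `^ beta) *
    (y `^ (- alpha) * y `^ beta))).
  by rewrite mulrACA ler_wpM2l // mulr_ge0 // powR_ge0.
apply: (@le_trans _ _ (x `^ (- (3 / 4)) * y `^ (- (3 / 4)))).
  by rewrite ler_pM ?decay // mulr_ge0 // powR_ge0.
have := sqr_ge0 (x `^ (- (3 / 4)) - y `^ (- (3 / 4))).
by have := powR_ge0 x (- (3 / 4)); have := powR_ge0 y (- (3 / 4)); nra.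
Qed.

End BracketWeights.

(** * From the decay hypothesis to the moment bound *)

Lemma decay_bracket (R : realType) (phi : int -> ell2 R) (alpha gamma : R) :
  (forall m, norm2 (phi m) = 1) -> 0 <= alpha -> 0 <= gamma ->
  (forall m n : int, n != m ->
    normc (phi m n) <= gamma / (`|(n - m)%:~R| `^ alpha)) ->
  forall m n, normc (phi m n) <=
    (1 + gamma * 2 `^ alpha) * bracket (n - m) `^ (- alpha).
Proof.
move=> phi1 alpha0 gamma0 decay m n.
have g0 : 0 <= gamma * 2 `^ alpha by rewrite mulr_ge0 ?powR_ge0.
(* On the diagonal the unit norm of [phi m] gives the bound, which explains the summand 1 of the
   constant. *)
have [->|nm] := eqVneq n m.
  rewrite subrr /bracket normr0 addr0 powR1 mulr1.
  by rewrite (le_trans (normc_le_norm2 _ _)) // phi1 lerDl.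
apply: le_trans (decay m n nm) _; rewrite /bracket.
set x := `|(n - m)%:~R| : R.
(* Distinct integers differ by at least 1, so 1 + x <= 2 x; this costs the factor 2^alpha. *)
have x1 : 1 <= x.
  by rewrite /x -intr_norm -[1]/(1%:~R) ler_int -gtz0_ge1 normr_gt0 subr_eq0.
have x0 : 0 < x := lt_le_trans ltr01 x1.
have y0 : 0 < 1 + x by rewrite addr_gt0.
apply: (@le_trans _ _ (gamma * 2 `^ alpha * (1 + x) `^ (- alpha))); last first.
  by rewrite ler_wpM2r ?powR_ge0 // lerDr.
rewrite -mulrA ler_wpM2l // powRN ler_pdivlMr ?powR_gt0 // mulrC.
rewrite ler_pdivrMr ?powR_gt0 // -powRM ?(ltW x0) //.
by apply: ge0_ler_powR; rewrite ?nnegrE ?mulr_ge0 ?(ltW x0) ?(ltW y0) //; lra.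
Qed.

Theorem lemma3p1 (R : realType) (H : operator R)
    (U : R -> {linear ell2 R -> ell2 R})
    (phi : int -> ell2 R) (alpha gamma : R)
    (H_sa : self_adjoint H)
    (U_exp : is_exp_mit H U)
    (phi_onb : orthonormal_basis phi)
    (phi_eig : forall m, eigenfunction H (phi m))
    (alpha_gt0 : 0 < alpha)
    (gamma_gt0 : 0 < gamma)
    (phi_decay : forall m n : int, n != m ->
       normc (phi m n) <= gamma / (`|(n - m)%:~R| `^ alpha))
    (q : R) (q_gt0 : 0 < q) (alpha_gt : 3 / 2 + q / 2 < alpha) :
  forall k : int, exists C : R,
    (ereal_sup [set \esum_(n in [set: int])
        (`|n%:~R| `^ q * normc (dot (U t (delta k)) (delta n)) ^+ 2)%:E
      | t in [set: R]] < C%:E)%E.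
Proof.
move=> k; have [W W0 HW] := @sum_bracket_bound R.
have [on _] := phi_onb.
have phi1 m : dot (phi m) (phi m) = 1 by rewrite on eqxx.
have nphi m : norm2 (phi m) = 1.
  apply/eqP; rewrite -(@eqrXn2 _ 2) ?norm2_ge0 ?ler01 // expr1n.
  by have := phi1 m; rewrite dot_norm2 => -[->].
set K := 1 + gamma * 2 `^ alpha.
have K0 : 0 <= K by rewrite addr_ge0 ?mulr_ge0 ?powR_ge0 // ltW.
have phiK m n : normc (phi m n) <= K * bracket (n - m) `^ (- alpha).
  exact: (decay_bracket _ _ _ _ nphi (ltW alpha_gt0) (ltW gamma_gt0) phi_decay).
have coef t m : normc (dot (U t (delta k)) (phi m)) = normc (phi m k).
  have [_ [l [dom_m Hm]]] := phi_eig m.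
  rewrite (normc_dot_evolution _ _ U_exp _ _ dom_m Hm (phi1 m)).
  by rewrite dotC dot_delta normcJ.
set beta := q / 2 + 3 / 4; pose M := K ^+ 2 * (2 * W).
have M0 : 0 <= M by rewrite mulr_ge0 ?sqr_ge0 ?mulr_ge0.
(* [M] collects one [K] for each of the two eigenfunction values and [2 * W] from the convolution;
   it is independent of t and n. *)
have pointwise t n :
    normc (dot (U t (delta k)) (delta n)) <= M * bracket (n - k) `^ (- beta).
  rewrite dot_delta; apply: (normc_le_expansion phi) => // s us.
  apply: (@le_trans _ _ (K ^+ 2 * \sum_(m <- s)
      bracket (k - m) `^ (- alpha) * bracket (n - m) `^ (- alpha))); last first.
    by rewrite /M -mulrA ler_wpM2l ?sqr_ge0 // bracket_convolution.
  rewrite mulr_sumr; apply: ler_sum => m _.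
  by rewrite coef expr2 mulrACA ler_pM ?normc_ge0.
pose C := bracket k `^ q * M ^+ 2 : R.
have C0 : 0 <= C by rewrite mulr_ge0 ?powR_ge0 ?sqr_ge0.
(* The supremum is at most [C * W]; adding 1 makes the inequality strict. *)
exists (C * W + 1); apply: (@le_lt_trans _ _ (C * W)%:E); last first.
  by rewrite lte_fin ltrDl.
(* The sum over Z is itself a supremum of finite sums, so a bound uniform in t and the finite set
   [X] suffices. *)
apply: ge_ereal_sup => _ [t _ <-]; apply: ge_ereal_sup => _ [X [finX _] <-].
rewrite fsbig_finite // sumEFin lee_fin.
have CW : C * \sum_(n <- finmap.enum_fset (fset_set X))
    bracket (n - k) `^ (- (3 / 2)) <= C * W.
  rewrite ler_wpM2l // -(big_map (fun n => n - k) xpredT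
    (fun j => bracket j `^ _)).
  by apply: HW; rewrite map_inj_uniq ?finmap.fset_uniq // => x y /addIr.
apply: le_trans CW; rewrite mulr_sumr; apply: ler_sum => n _.
set b := bracket (n - k); have b0 : 0 < b := bracket_gt0 _.
(* Here |n| <= <n> <= <n-k> <k>, which moves the weight to n - k. *)
have nq : `|n%:~R : R| `^ q <= bracket k `^ q * b `^ q.
  rewrite -powRM ?(ltW b0) ?(ltW (bracket_gt0 _)) //.
  apply: ge0_ler_powR; rewrite ?(ltW q_gt0) ?nnegrE ?mulr_ge0 ?(ltW b0)
    ?(ltW (bracket_gt0 _)) //.
  rewrite mulrC; apply: le_trans (bracketD _ _).
  by rewrite subrK lerDr.
apply: (@le_trans _ _ ((bracket k `^ q * b `^ q) *
    (M * b `^ (- beta)) ^+ 2)).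
  rewrite ler_pM ?powR_ge0 ?sqr_ge0 //.
  by rewrite ler_sqr ?nnegrE ?normc_ge0 ?mulr_ge0 ?powR_ge0 ?pointwise.
(* The exponents combine to q - 2 beta = -3/2, the summable power. *)
rewrite /C exprMn mulrACA ler_wpM2l // -powR_mulrn ?powR_ge0 // -powRrM.
rewrite -powRD ?(gt_eqF b0) ?implybT //.
by rewrite (_ : q + _ = - (3 / 2)) // /beta; field.
Qed.
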